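(* For every network graph $G=(V,E)$ and every local dimension $d\ge2$, the operator $$W_E=-d\bigotimes_{e\in E}\Phi_e+\frac{d+1}{2}\bigotimes_{e\in E}\frac{\mathbb{I}_e+d\,\Phi_e}{d+1}$$ is a sub-symmetric witness (SSW) for $G$.
   Context: Network: $G=(V,E)$ is a finite connected simple undirected graph with $|V|\ge2$; vertices are parties. To each edge $e=\{u,v\}$ is attached $\mathcal{H}_e=\mathbb{C}^d\otimes\mathbb{C}^d$, one tensor factor held by $u$ and the other by $v$; the network Hilbert space is $\bigotimes_{e\in E}\mathcal{H}_e$, and each party $v$ holds all factors located at $v$. $\mathbb{I}_e$ is the identity on $\mathcal{H}_e$ and $\Phi_e=|\phi^+\rangle\langle\phi^+|$ with $|\phi^+\rangle=\frac1{\sqrt d}\sum_{i=0}^{d-1}|ii\rangle$. For $S\subseteq V$ with $S\ne\emptyset,V$ (nontrivial), $\Gamma_S$ denotes the partial transpose (computational basis) on all tensor factors held by parties in $S$. A Hermitian operator $W$ is fully decomposable if for every nontrivial $S\subseteq V$ there exist positive semidefinite $P_S,Q_S$ with $W=P_S+Q_S^{\Gamma_S}$. A sub-symmetric witness (SSW) for $G$ is a fully decomposable operator of the form $\sum_{T\subseteq E}w_T\bigotimes_{e\in T}\Phi_e\otimes\bigotimes_{e\notin T}(\mathbb{I}_e-\Phi_e)$ with $w_T\in\mathbb{R}$. *)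

(* Defs.v *)
From mathcomp Require Import all_boot all_order all_algebra.
From mathcomp Require Import spectral.
From mathcomp Require Import reals.
From mathcomp.real_closed Require Import complex.

Set Implicit Arguments.
Unset Strict Implicit.
Unset Printing Implicit Defensive.

Import Order.TTheory GRing.Theory Num.Theory.
Local Open Scope ring_scope.
Local Open Scope sesquilinear_scope.

(* (C^d)^{(x) I}, the tensor product of copies of C^d labelled by a finite type
   I, has the configurations x : cfg d I as its computational basis.  Vectors
   and operators are matrices whose indices enumerate this basis. *)
Definition cfg (d : nat) (I : finType) : finType := {ffun I -> 'I_d}.

Notation ketsp C d I := 'cV[C]_#|cfg d I|.
Notation opsp C d I := 'M[C]_#|cfg d I|.

Section Operators.
Variables (C : numClosedFieldType) (d : nat).

Definition ket (I : finType) (x : cfg d I) : ketsp C d I :=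
  delta_mx (enum_rank x) 0.

(* <x| A |y> *)
Definition entry (I : finType) (A : opsp C d I) (x y : cfg d I) : C :=
  A (enum_rank x) (enum_rank y).

Definition op_of (I : finType) (f : cfg d I -> cfg d I -> C) : opsp C d I :=
  \matrix_(i, j) f (enum_val i) (enum_val j).

Definition psd n (A : 'M[C]_n) : Prop :=
  A \is hermsymmx /\ forall v : 'cV[C]_n, 0 <= (v ^t* *m A *m v) 0 0.

(* Tensor product of operators A i on (C^d)^{(x) J i}, an operator on the
   tensor product of all the factors, labelled by pairs (i, j : J i). *)
Definition restr (I : finType) (J : I -> finType)
    (x : cfg d {i : I & J i}) (i : I) : cfg d (J i) :=
  [ffun j => x (Tagged J j)].

Definition tensor (I : finType) (J : I -> finType)
    (A : forall i, opsp C d (J i)) : opsp C d {i : I & J i} :=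
  op_of (fun x y => \prod_(i : I) entry (A i) (restr x i) (restr y i)).

(* Partial transpose on the factors labelled by D:
   <x| A^Gamma |y> = <x'| A |y'>, with x', y' obtained from x, y by exchanging
   their values on D. *)
Definition splice (I : finType) (D : {set I}) (x y : cfg d I) : cfg d I :=
  [ffun i => if i \in D then y i else x i].

Definition ptranspose (I : finType) (D : {set I}) (A : opsp C d I) :
    opsp C d I :=
  op_of (fun x y => entry A (splice D x y) (splice D y x)).

End Operators.

Arguments ket C {d I} x.

Section Networks.
Variables (V : finType) (E : {set {set V}}).

Definition network_graph : Prop :=
  [/\ (2 <= #|V|)%N,
      forall e : {set V}, e \in E -> #|e| = 2
    & forall u v : V, connect [rel a b | [set a; b] \in E] u v].

Definition edge : finType := {e : {set V} | e \in E}.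

(* The two factors of H_e, e = {u, v}, are labelled by the parties holding
   them, i.e., by the elements of e. *)
Definition endpoint (e : edge) : finType := {v : V | v \in val e}.

Definition factor : finType := {e : edge & endpoint e}.

Definition held_by (S : {set V}) : {set factor} :=
  [set h : factor | val (tagged h) \in S].

Variables (C : numClosedFieldType) (d : nat).

Definition phi_plus (e : edge) : ketsp C d (endpoint e) :=
  (sqrtC d%:R)^-1 *: \sum_(i < d) ket C ([ffun=> i] : cfg d (endpoint e)).

Definition Phi (e : edge) : opsp C d (endpoint e) :=
  phi_plus e *m (phi_plus e) ^t*.

Definition Gamma (S : {set V}) (A : opsp C d factor) : opsp C d factor :=
  ptranspose (held_by S) A.

Definition fully_decomposable (W : opsp C d factor) : Prop :=
  W \is hermsymmx /\
  forall S : {set V}, S != set0 -> S != [set: V] ->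
    exists P Q : opsp C d factor, [/\ psd P, psd Q & W = P + Gamma S Q].

Definition SSW (W : opsp C d factor) : Prop :=
  fully_decomposable W /\
  exists w : {set edge} -> C,
    (forall T, w T \is Num.real) /\
    W = \sum_(T : {set edge})
          w T *: tensor (fun e => if e \in T then Phi e else 1%:M - Phi e).

Definition W_E : opsp C d factor :=
  - d%:R *: tensor (fun e => Phi e)
  + (d%:R + 1) / 2 *:
      tensor (fun e => (d%:R + 1)^-1 *: (1%:M + d%:R *: Phi e)).

End Networks.

(* Main.v *)
(* Fix a nontrivial S.  By connectedness some edge f has exactly one endpoint in
   S.  With rho = (1 + d Phi) / (d + 1), the identity
   (d + 1)/2 rho - (1 - d Phi)/2 = d Phi on the factor f gives
     W_E = d Phi_f (x) (rho_rest - Phi_rest) + (1 - d Phi_f)/2 (x) rho_rest.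
   The first summand is positive because rho = Phi + (1 - Phi)/(d + 1).  On an
   edge cut by S, the partial transpose of d Phi is the flip F, with F^2 = 1, so
   that (1 - d Phi)/2 and rho become multiples of the projectors (1 -+ F)/2; on
   the other edges rho is unchanged.  Hence the second summand has a positive
   partial transpose. *)

Require Import Defs.
From mathcomp Require Import all_boot all_order all_algebra.
From mathcomp Require Import reals.
From mathcomp.real_closed Require Import complex.
From mathcomp Require Import spectral ring.

Set Implicit Arguments.
Unset Strict Implicit.
Unset Printing Implicit Defensive.

Import Order.TTheory GRing.Theory Num.Theory.
Local Open Scope ring_scope.
Local Open Scope sesquilinear_scope.

(** * Gram matrices and positive semidefiniteness *)

Section Gram.
Variable C : numClosedFieldType.

(* Equivalent to [psd], but visibly stable under tensor products. *)
Definition gram n (A : 'M[C]_n) := exists B : 'M[C]_n, A = B^t* *m B.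

Lemma adjmxM m n p (A : 'M[C]_(m, n)) (B : 'M[C]_(n, p)) :
  (A *m B)^t* = B^t* *m A^t*.
Proof. by rewrite trmx_mul map_mxM. Qed.

Lemma hermsymmxP n (A : 'M[C]_n) : reflect (A^t* = A) (A \is hermsymmx).
Proof.
by apply: (iffP (is_hermitianmxP _ _ _)); rewrite expr0 scale1r => /esym.
Qed.

Lemma gram_hermsym n (A : 'M[C]_n) : gram A -> A \is hermsymmx.
Proof. by case=> B ->; apply/hermsymmxP; rewrite adjmxM trmxCK. Qed.

Lemma gram_psd n (A : 'M[C]_n) : gram A -> psd A.
Proof.
move=> gA; split; first exact: gram_hermsym.
move=> v; case: gA => B ->.
rewrite mulmxA -adjmxM -mulmxA mxE sumr_ge0 // => i _.
by rewrite !mxE mulrC mul_conjC_ge0.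
Qed.

Lemma hermsymmx_sum n (I : finType) (w : I -> C) (A : I -> 'M[C]_n) :
  (forall i, w i \is Num.real) -> (forall i, A i \is hermsymmx) ->
  \sum_i w i *: A i \is hermsymmx.
Proof.
move=> wR hA; apply/hermsymmxP/matrixP => i j.
rewrite !mxE !summxE rmorph_sum; apply: eq_bigr => k _.
rewrite !mxE rmorphM /= (CrealP (wR k)).
by have /hermsymmxP/matrixP/(_ i j) := hA k; rewrite !mxE => ->.
Qed.

(** Argued on quadratic forms, since Gram factors of the summands do not add up to one of the
    sum. *)
Lemma psd_sum n (I : finType) (w : I -> C) (A : I -> 'M[C]_n) :
  (forall i, 0 <= w i) -> (forall i, psd (A i)) -> psd (\sum_i w i *: A i).
Proof.
move=> w0 pA; split.
  by apply: hermsymmx_sum => i; [rewrite ger0_real | case: (pA i)].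
move=> v; rewrite mulmx_sumr mulmx_suml summxE sumr_ge0 // => i _.
rewrite -scalemxAr -scalemxAl mxE mulr_ge0 //.
by case: (pA i).
Qed.

(** [X] and [1%:M - X] are orthogonal projectors, so combining them with coefficients [sqrtC a] and
    [sqrtC b] gives a Hermitian square root. *)
Lemma gram_proj n (X : 'M[C]_n) (a b : C) :
  X^t* = X -> X *m X = X -> 0 <= a -> 0 <= b ->
  gram (a *: X + b *: (1%:M - X)).
Proof.
move=> Xh XX a0 b0.
exists (sqrtC a *: X + sqrtC b *: (1%:M - X)).
have XY : X *m (1%:M - X) = 0 by rewrite mulmxBr mulmx1 XX subrr.
have YX : (1%:M - X) *m X = 0 by rewrite mulmxBl mul1mx XX subrr.
have YY : (1%:M - X) *m (1%:M - X) = 1%:M - X.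
  by rewrite mulmxBr mulmx1 YX subr0.
have ->: (sqrtC a *: X + sqrtC b *: (1%:M - X))^t* =
   sqrtC a *: X + sqrtC b *: (1%:M - X).
  apply/matrixP=> i j; rewrite !mxE !(rmorphD, rmorphM, rmorphN) /=.
  rewrite rmorph_nat [j == i]eq_sym.
  have <- : X i j = (X j i)^* by rewrite -[in LHS]Xh !mxE.
  by rewrite !(CrealP _) // ger0_real ?sqrtC_ge0.
rewrite mulmxDl !mulmxDr -!scalemxAl -!scalemxAr XX YY XY YX !scaler0 addr0 add0r.
by rewrite !scalerA -!expr2 !sqrtCK.
Qed.

End Gram.

(** * Tensor products and their partial transposes *)

Section Tensor.
Variables (C : numClosedFieldType) (d : nat).

Lemma entry_op_of (I : finType) (f : cfg d I -> cfg d I -> C) x y :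
  entry (op_of f) x y = f x y.
Proof. by rewrite /entry mxE !enum_rankK. Qed.

Lemma entryP (I : finType) (A B : 'M[C]_#|cfg d I|) :
  (forall x y, entry A x y = entry B x y) -> A = B.
Proof.
move=> AB; apply/matrixP => i j.
by have := AB (enum_val i) (enum_val j); rewrite /entry !enum_valK.
Qed.

Lemma entryM (I : finType) (A B : 'M[C]_#|cfg d I|) x z :
  entry (A *m B) x z = \sum_y entry A x y * entry B y z.
Proof.
rewrite /entry mxE (reindex (@enum_rank (cfg d I))) //.
exact/onW_bij/enum_rank_bij.
Qed.

Lemma entry_adj (I : finType) (A : 'M[C]_#|cfg d I|) x y :
  entry (A^t*) x y = (entry A y x)^*.
Proof. by rewrite /entry !mxE. Qed.

Variables (I : finType) (J : I -> finType).
Implicit Types A B : forall i, 'M[C]_#|cfg d (J i)|.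

Lemma entry_tensor A x y :
  entry (tensor A) x y = \prod_i entry (A i) (restr x i) (restr y i).
Proof. exact: entry_op_of. Qed.

(** Distributivity: a configuration of all factors amounts to an independent choice, for each [i],
    of a configuration on [J i]. *)
Lemma sum_restr (F : forall i, cfg d (J i) -> C) :
  \sum_(x : cfg d {i : I & J i}) \prod_i F i (restr x i) =
  \prod_i \sum_(y : cfg d (J i)) F i y.
Proof.
pose T_ i : finType := cfg d (J i).
pose h (t : fprod T_) : cfg d {i : I & J i} :=
  [ffun k => t (tag k) (tagged k)].
pose g (x : cfg d {i : I & J i}) : fprod T_ :=
  fprod_of_fun (fun i => restr x i : T_ i).
have gK : cancel h g.
  move=> t; apply/fprodP => i; rewrite fprodE; apply/ffunP => j.
  by rewrite !ffunE.
have hK : cancel g h.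
  by move=> x; apply/ffunP => -[i j]; rewrite ffunE fprodE ffunE.
rewrite (reindex h) /=; last by exists g => ? _; [exact: gK | exact: hK].
pose P_ i : {ffun T_ i -> C} := [ffun y => F i y].
transitivity (\sum_(t : fprod T_) \prod_(i in I) P_ i (t i)).
  apply: eq_bigr => t _; apply: eq_bigr => i _; rewrite ffunE.
  by congr (F i _); apply/ffunP => j; rewrite !ffunE.
(* Distributivity is applied over the tagged union of the [T_ i]; [untag 0] extends [P_ i] to it by
   0 off the tag [i]. *)
rewrite (big_fprod _ _ P_) -(bigA_distr_big_dep _ (fun i => untag 0 (P_ i))).
apply: eq_bigr => i _; rewrite -(big_tag (fun k => P_ k : T_ k -> C)) /=.
by apply: eq_bigr => y _; rewrite ffunE.
Qed.

Lemma tensorM A B : tensor A *m tensor B = tensor (fun i => A i *m B i).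
Proof.
apply: entryP => x z; rewrite entryM entry_tensor.
under [RHS]eq_bigr do rewrite entryM.
rewrite -sum_restr; apply: eq_bigr => y _.
by rewrite !entry_tensor -big_split.
Qed.

Lemma tensor_adj A : (tensor A)^t* = tensor (fun i => (A i)^t*).
Proof.
apply: entryP => x y; rewrite entry_adj !entry_tensor rmorph_prod.
by apply: eq_bigr => i _; rewrite entry_adj.
Qed.

Lemma eq_tensor A B : (forall i, A i = B i) -> tensor A = tensor B.
Proof.
move=> AB; apply: entryP => x y.
by rewrite !entry_tensor; apply: eq_bigr => i _; rewrite AB.
Qed.

(** Tensoring Gram factors of the [A i] gives a Gram factor of the product. *)
Lemma gram_tensor A : (forall i, gram (A i)) -> gram (tensor A).
Proof.
move=> /fin_all_exists[B AB].
by exists (tensor B); rewrite tensor_adj tensorM; apply: eq_tensor.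
Qed.

Lemma tensor_expand (a b : I -> C) A B :
  tensor (fun i => a i *: A i + b i *: B i) =
  \sum_(T : {set I}) (\prod_i (if i \in T then a i else b i)) *:
     tensor (fun i => if i \in T then A i else B i).
Proof.
apply: entryP => x y; rewrite entry_tensor [RHS]/entry summxE.
under eq_bigr do rewrite /entry !mxE -/(entry _ _ _) -/(entry _ _ _).
rewrite bigA_distr; apply: eq_bigr => T _.
rewrite mxE -/(entry _ _ _) entry_tensor -big_split.
by apply: eq_bigr => i _; case: (i \in T).
Qed.

Definition fiber (D : {set {i : I & J i}}) i : {set J i} :=
  [set j | Tagged J j \in D].

(** Exchanging values on [D] commutes with restriction to each block [J i]. *)
Lemma tensor_ptranspose D A :
  ptranspose D (tensor A) = tensor (fun i => ptranspose (fiber D i) (A i)).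
Proof.
apply: entryP => x y; rewrite !(entry_op_of, entry_tensor).
apply: eq_bigr => i _; rewrite entry_op_of.
by congr (entry _ _ _); apply/ffunP => j; rewrite !ffunE inE.
Qed.

Lemma ptransposeK (K : finType) (D : {set K}) :
  involutive (@ptranspose C d K D).
Proof.
move=> A; apply: entryP => x y; rewrite !entry_op_of.
by congr (entry _ _ _); apply/ffunP => k; rewrite !ffunE; case: (k \in D).
Qed.

End Tensor.

(** * Linearity of the partial transpose *)

Section Ptranspose.
Variables (C : numClosedFieldType) (d : nat) (K : finType) (D : {set K}).
Implicit Types A B : 'M[C]_#|cfg d K|.

Lemma ptransposeD A B :
  ptranspose D (A + B) = ptranspose D A + ptranspose D B.
Proof. by apply/matrixP => i j; rewrite !mxE /entry !mxE. Qed.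

Lemma ptransposeZ (a : C) A : ptranspose D (a *: A) = a *: ptranspose D A.
Proof. by apply/matrixP => i j; rewrite !mxE /entry !mxE. Qed.

Lemma ptransposeN A : ptranspose D (- A) = - ptranspose D A.
Proof. by apply/matrixP => i j; rewrite !mxE /entry !mxE. Qed.

Lemma entry1 (x y : cfg d K) : entry (1%:M : 'M[C]__) x y = (x == y)%:R.
Proof. by rewrite /entry mxE (inj_eq enum_rank_inj). Qed.

Lemma ptranspose1 : ptranspose D (1%:M : 'M[C]_#|cfg d K|) = 1%:M.
Proof.
apply: entryP => x y; rewrite entry_op_of !entry1; congr (nat_of_bool _)%:R.
apply/eqP/eqP => [xy|-> //]; apply/ffunP => k.
by have := congr1 (fun f : cfg d K => f k) xy; rewrite !ffunE; case: (k \in D).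
Qed.

End Ptranspose.

(** * The projector on the maximally entangled state of an edge *)

Section MaxEntangled.
Variables (V : finType) (E : {set {set V}}) (C : numClosedFieldType) (d : nat).
Hypotheses (hE : forall e : {set V}, e \in E -> #|e| = 2) (hd : (0 < d)%N).
Implicit Types e : edge E.

Local Notation Phi e := (@Defs.Phi V E C d e).

Let d_neq0 : d%:R != 0 :> C. Proof. by rewrite pnatr_eq0 -lt0n. Qed.
Let dS_neq0 : d%:R + 1 != 0 :> C. Proof. by rewrite natr1 pnatr_eq0. Qed.
Let two_neq0 : 2 != 0 :> C. Proof. by rewrite pnatr_eq0. Qed.

Lemma card_endpoint e : #|endpoint e| = 2.
Proof. by rewrite card_sig -[RHS](hE (valP e)); apply: eq_card. Qed.

(** The endpoints of an edge carry no order, so the kets |ii> are singled out as the constant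
    configurations. *)
Definition constb (K : finType) (x : cfg d K) :=
  [forall a, forall b, x a == x b].

(** An edge has an endpoint [a], so only the term [i = x a] can be nonzero. *)
Lemma sum_const e (x : cfg d (endpoint e)) :
  \sum_(i < d) (x == [ffun=> i])%:R = (constb x)%:R :> C.
Proof.
have [a _] : exists a : endpoint e, true.
  have /card_gt0P[a _] : (0 < #|endpoint e|)%N by rewrite card_endpoint.
  by exists a.
rewrite (bigD1 (x a)) //= big1 ?addr0 => [|i ix].
  congr (nat_of_bool _)%:R; apply/eqP/forallP => [xE b|xE].
    by apply/forallP => c; rewrite xE !ffunE.
  by apply/ffunP => b; rewrite ffunE; apply/eqP/(forallP (xE b)).
by case: eqP => // xE; rewrite xE ffunE eqxx in ix.
Qed.

Lemma phi_plusE e (x : cfg d (endpoint e)) :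
  phi_plus C d e (enum_rank x) 0 = (sqrtC d%:R)^-1 * (constb x)%:R.
Proof.
rewrite mxE summxE -sum_const; congr (_ * _); apply: eq_bigr => i _.
by rewrite mxE eqxx andbT (inj_eq enum_rank_inj).
Qed.

Lemma conj_sqrt_nat : ((sqrtC d%:R)^-1)^* = (sqrtC d%:R)^-1 :> C.
Proof. by apply: CrealP; rewrite ger0_real // invr_ge0 sqrtC_ge0. Qed.

Lemma entry_Phi e (x y : cfg d (endpoint e)) :
  entry (Phi e) x y = d%:R^-1 * (constb x && constb y)%:R.
Proof.
rewrite /entry mxE big_ord1 phi_plusE [X in _ * X]mxE [X in _ * X^*]mxE.
rewrite phi_plusE rmorphM /= conj_sqrt_nat rmorph_nat mulrACA -invfM -expr2.
by rewrite sqrtCK -natrM mulnb.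
Qed.

Lemma Phi_adj e : (Phi e)^t* = Phi e.
Proof. by rewrite adjmxM trmxCK. Qed.

Lemma Phi_idem e : Phi e *m Phi e = Phi e.
Proof.
apply: entryP => x z; rewrite entryM.
under eq_bigr do rewrite !entry_Phi.
transitivity (d%:R^-1 ^+ 2 * (constb x && constb z)%:R *
   \sum_y (constb (y : cfg d (endpoint e)))%:R : C).
  rewrite mulr_sumr; apply: eq_bigr => y _.
  rewrite mulrACA -expr2 -mulrA -!natrM !mulnb; congr (_ * _%:R).
  by case: (constb x); case: (constb y); case: (constb z).
(* The [d] constant configurations cancel one of the two factors 1/d. *)
suff -> : \sum_(y : cfg d (endpoint e)) (constb y)%:R = d%:R :> C.
  by rewrite entry_Phi; field.
under eq_bigr do rewrite -sum_const.
rewrite exchange_big /=.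
under eq_bigr => i _.
  rewrite (bigD1 [ffun=> i]) //= eqxx big1 ?addr0; last first.
    by move=> y /negPf->.
over.
by rewrite sumr_const card_ord.
Qed.

Lemma gram_Phi e (a b : C) :
  0 <= a -> 0 <= b -> gram (a *: Phi e + b *: (1%:M - Phi e)).
Proof. by apply: gram_proj; [exact: Phi_adj | exact: Phi_idem]. Qed.

(** Up to the factor [d], the isotropic state of fidelity 1/d, at the border of separability. *)
Definition iso_state e : 'M[C]_#|cfg d (endpoint e)| :=
  (d%:R + 1)^-1 *: (1%:M + d%:R *: Phi e).

Lemma iso_stateE e :
  iso_state e = 1 *: Phi e + (d%:R + 1)^-1 *: (1%:M - Phi e).
Proof.
rewrite scale1r scalerBr /iso_state scalerDr scalerA addrCA; congr (_ + _).
rewrite -[X in X - _]scale1r -scalerBl; congr (_ *: _).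
by field.
Qed.

(** Either nothing is exchanged, or the full transpose is taken, and the entries of [Phi e] are
    symmetric. *)
Lemma ptranspose_Phi_trivial e (D : {set endpoint e}) :
  (D == set0) || (D == setT) -> ptranspose D (Phi e) = Phi e.
Proof.
move=> trD; apply: entryP => x y; rewrite entry_op_of !entry_Phi.
case/orP: trD => /eqP->.
  have splice0 (x' y' : cfg d (endpoint e)) : splice set0 x' y' = x'.
    by apply/ffunP => k; rewrite ffunE inE.
  by rewrite !splice0.
have spliceT (x' y' : cfg d (endpoint e)) : splice setT x' y' = y'.
  by apply/ffunP => k; rewrite ffunE inE.
by rewrite !spliceT andbC.
Qed.

(** * The flip on an edge cut by the bipartition *)

Section Swap.
Variables (e : edge E) (D : {set endpoint e}).
Hypotheses (D0 : D != set0) (DT : D != setT).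

(* The flip of the two factors of [e], since [D] contains exactly one of them. *)
Definition swap_op := d%:R *: ptranspose D (Phi e).

Lemma crossing_endpoints :
  exists a b, [/\ a \in D, b \notin D & forall k, (k == a) || (k == b)].
Proof.
have [a aD] := set0Pn _ D0.
have [b bD] : exists b, b \notin D.
  by apply/existsP; rewrite -negb_forall; apply: contra DT => /forallP DA;
     apply/eqP/setP => k; rewrite DA inE.
exists a, b; split=> // k.
have ab : a != b by apply: contraNneq bD => <-.
have : [set a; b] == setT.
  by rewrite eqEcard subsetT cardsT card_endpoint cards2 ab.
by move=> /eqP/setP/(_ k); rewrite !inE.
Qed.

(** With [a] in [D] and [b] outside, both spliced configurations are constant exactly when
    [y a = x b] and [x a = y b]. The involution [s] exchanges [a] and [b]. *)
Lemma entry_swap : exists2 s : endpoint e -> endpoint e, involutive s &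
  forall x y, entry swap_op x y = (y == [ffun k => x (s k)])%:R.
Proof.
have [a [b [aD bD abE]]] := crossing_endpoints.
have ba : (b == a) = false by apply: contraNF bD => /eqP->.
exists (fun k => if k == a then b else a) => [k|x y].
  by have /orP[/eqP->|/eqP->] := abE k; rewrite ?eqxx ?ba ?eqxx.
have cE z : constb z = (z a == z b).
  apply/forallP/eqP => [/(_ a)/forallP/(_ b)/eqP//|zab k].
  apply/forallP => l; have /orP[/eqP->|/eqP->] := abE k;
  by have /orP[/eqP->|/eqP->] := abE l; rewrite ?zab.
have -> : entry swap_op x y = d%:R * entry (ptranspose D (Phi e)) x y.
  by rewrite /entry mxE.
rewrite entry_op_of entry_Phi mulrA mulfV // mul1r; congr (nat_of_bool _)%:R.
rewrite !cE !ffunE aD (negPf bD).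
apply/andP/eqP => [[/eqP ya /eqP xa]|->].
  by apply/ffunP => k; rewrite ffunE; have /orP[/eqP->|/eqP->] := abE k;
     rewrite ?eqxx ?ba.
by rewrite !ffunE ?eqxx ?ba !eqxx.
Qed.

Lemma swap_adj : swap_op^t* = swap_op.
Proof.
have [s sK sE] := entry_swap.
apply: entryP => x y; rewrite entry_adj !sE rmorph_nat; congr (nat_of_bool _)%:R.
by apply/eqP/eqP => ->; apply/ffunP => k; rewrite !ffunE sK.
Qed.

Lemma swap_sqr : swap_op *m swap_op = 1%:M.
Proof.
have [s sK sE] := entry_swap.
apply: entryP => x z; rewrite entryM entry1.
under eq_bigr do rewrite !sE.
rewrite (bigD1 [ffun k => x (s k)]) //= big1 ?addr0.
  rewrite eqxx mul1r [x == z]eq_sym; congr (nat_of_bool (z == _))%:R.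
  by apply/ffunP => k; rewrite !ffunE sK.
by move=> y /negPf->; rewrite mul0r.
Qed.

Lemma gram_swap (a b : C) : 0 <= a -> 0 <= b ->
  gram (a *: (1%:M + swap_op) + b *: (1%:M - swap_op)).
Proof.
move=> a0 b0; move: swap_op swap_adj swap_sqr => F Fh FF.
(* From [F] Hermitian with square 1, the projectors on its eigenvalues 1 and -1 are [X] and
   [1%:M - X]; the weights [2 * a] and [2 * b] below absorb the factor 1/2. *)
pose X := 2^-1 *: (1%:M + F).
have XX : X *m X = X.
  rewrite /X -scalemxAl -scalemxAr mulmxDl mul1mx mulmxDr mulmx1 FF.
  rewrite [F + _]addrC -mulr2n -scaler_nat !scalerA.
  by congr (_ *: _); rewrite mulVf // mulr1.
have Xh : X^t* = X.
  apply/matrixP => i j.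
  have FE : (F j i)^* = F i j by rewrite -[in RHS]Fh !mxE.
  rewrite !mxE rmorphM rmorphD /= FE.
  by rewrite fmorphV !rmorph_nat [j == i]eq_sym.
have := gram_proj Xh XX (mulr_ge0 (ler0n _ 2) a0) (mulr_ge0 (ler0n _ 2) b0).
congr gram; congr (_ + _).
  by rewrite scalerA mulrAC mulfV // mul1r.
rewrite mulrC -scalerA; congr (_ *: _).
rewrite scalerBr scalerA mulfV // scale1r scaler_nat mulr2n opprD addrA.
by rewrite addrK.
Qed.

End Swap.

(** An uncut edge keeps the eigenvalues 1 and 1/(d+1); on a cut edge the result is (1 + F)/(d + 1),
    F being the flip. *)
Lemma gram_ptranspose_iso e (D : {set endpoint e}) :
  gram (ptranspose D (iso_state e)).
Proof.
have dV0 : 0 <= (d%:R + 1 : C)^-1 by rewrite invr_ge0 addr_ge0.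
rewrite /iso_state ptransposeZ ptransposeD ptransposeZ ptranspose1.
have [trD|] := boolP ((D == set0) || (D == setT)).
  rewrite ptranspose_Phi_trivial // -/(iso_state e) iso_stateE.
  exact: gram_Phi.
rewrite negb_or => /andP[D0 DT].
by have := gram_swap D0 DT dV0 (lexx 0); rewrite scale0r addr0.
Qed.

Lemma gram_ptranspose_anti e (D : {set endpoint e}) :
  D != set0 -> D != setT ->
  gram (ptranspose D (2^-1 *: (1%:M - d%:R *: Phi e))).
Proof.
move=> D0 DT; rewrite ptransposeZ ptransposeD ptransposeN ptransposeZ ptranspose1.
have h0 : 0 <= 2^-1 :> C by rewrite invr_ge0.
by have := gram_swap D0 DT (lexx 0) h0; rewrite scale0r add0r.
Qed.

(** * Expansion in the projectors of the SSW form *)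

Local Notation projT T :=
  (tensor (fun e => if e \in T then Phi e else 1%:M - Phi e)).

Lemma psd_projT (T : {set edge E}) : psd (projT T).
Proof.
apply/gram_psd/gram_tensor => e.
have g1 := gram_Phi e ler01 (lexx 0).
have g2 := gram_Phi e (lexx 0) ler01.
by rewrite !scale0r !scale1r ?add0r ?addr0 in g1 g2; case: ifP.
Qed.

Lemma tensor_Phi_expand :
  tensor (fun e => Phi e) = \sum_(T : {set edge E}) (T == setT)%:R *: projT T.
Proof.
rewrite (bigD1 setT) //= eqxx scale1r big1 ?addr0 => [|T /negPf->].
  by apply: eq_tensor => e; rewrite inE.
by rewrite scale0r.
Qed.

(** The eigenvalue of [tensor iso_state] on the range of [projT T]. *)
Definition iso_weight (T : {set edge E}) : C :=
  \prod_(e : edge E) (if e \in T then 1 else (d%:R + 1)^-1).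

Lemma tensor_iso_expand :
  tensor iso_state = \sum_(T : {set edge E}) iso_weight T *: projT T.
Proof. by rewrite -tensor_expand; apply: eq_tensor => e; exact: iso_stateE. Qed.

Lemma W_E_expand :
  W_E E C d = \sum_(T : {set edge E})
    (- d%:R * (T == setT)%:R + (d%:R + 1) / 2 * iso_weight T) *: projT T.
Proof.
rewrite /W_E -/iso_state tensor_Phi_expand tensor_iso_expand !scaler_sumr.
by rewrite -big_split; apply: eq_bigr => T _; rewrite /= scalerDl !scalerA.
Qed.

Lemma W_E_weight_real (T : {set edge E}) :
  - d%:R * (T == setT)%:R + (d%:R + 1) / 2 * iso_weight T \is @Num.real C.
Proof.
have iR : iso_weight T \is Num.real.
  apply: ger0_real; apply: prodr_ge0 => e _.
  by case: ifP => _ //; rewrite invr_ge0 addr_ge0.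
by rewrite realD ?realM ?realN ?realV ?realD ?realn ?real1.
Qed.

(** * Splitting the witness at a cut edge *)

Definition cut_op (f e : edge E) : 'M[C]_#|cfg d (endpoint e)| :=
  if e == f then 2^-1 *: (1%:M - d%:R *: Phi e) else iso_state e.

Lemma gram_Gamma_cut (S : {set V}) (f : edge E) (u v : V) :
  val f = [set u; v] -> u \in S -> v \notin S ->
  gram (Gamma S (tensor (cut_op f))).
Proof.
move=> fE uS vS; rewrite /Gamma tensor_ptranspose; apply: gram_tensor => e.
rewrite /cut_op; case: eqP => [->|_]; last exact: gram_ptranspose_iso.
have uf : u \in val f by rewrite fE !inE eqxx.
have vf : v \in val f by rewrite fE !inE eqxx orbT.
apply: gram_ptranspose_anti.
  by apply/set0Pn; exists (exist _ u uf); rewrite !inE.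
by apply: contraNneq vS => /setP/(_ (exist _ v vf)); rewrite !inE.
Qed.

(** The two tensors differ only at [f], where the difference of the factors is [d%:R *: Phi f]. The
    explicit coefficient 0 on its complement puts the result in the shape that [tensor_expand]
    takes. *)
Lemma iso_sub_cut (f : edge E) :
  (d%:R + 1) / 2 *: tensor iso_state - tensor (cut_op f) =
  tensor (fun e => (if e == f then d%:R else 1) *: Phi e
    + (if e == f then 0 else (d%:R + 1)^-1) *: (1%:M - Phi e)).
Proof.
apply: entryP => x y.
have entryB (A B : 'M[C]_#|cfg d (factor E)|) (c : C) :
  entry (c *: A - B) x y = c * entry A x y - entry B x y by rewrite /entry !mxE.
rewrite entryB !entry_tensor (bigD1 f) //= [X in _ - X](bigD1 f) //=.
rewrite [RHS](bigD1 f) //= /cut_op !eqxx.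
pose rest := \prod_(e | e != f) entry (iso_state e) (restr x e) (restr y e).
rewrite [X in _ - _ * X](_ : _ = rest); last first.
  by apply: eq_bigr => e /negPf->.
rewrite [X in _ = _ * X](_ : _ = rest); last first.
  by apply: eq_bigr => e /negPf->; rewrite iso_stateE.
rewrite mulrA -mulrBl; congr (_ * _).
rewrite /iso_state /entry !mxE.
by field.
Qed.

Lemma psd_W_E_sub_cut (f : edge E) : psd (W_E E C d - tensor (cut_op f)).
Proof.
rewrite /W_E -/iso_state -addrA iso_sub_cut tensor_expand tensor_Phi_expand.
rewrite scaler_sumr -big_split /=.
under eq_bigr do rewrite scalerA -scalerDl.
apply: psd_sum => [T|T]; last exact: psd_projT.
(* At [T = setT] the product is [d], from [f] alone, and cancels the weight of
   [- d%:R *: tensor Phi]; every other [T] keeps a product of nonnegative factors. *)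
have [->|TT] := eqVneq T setT.
  rewrite mulr1 (bigD1 f) //= inE eqxx big1 ?mulr1 ?addNr // => e /negPf->.
  by rewrite inE.
rewrite mulr0 add0r prodr_ge0 // => e _.
by do 2!case: ifP => _ //; rewrite invr_ge0 addr_ge0.
Qed.

End MaxEntangled.

(** * Crossing edges, and assembly of the decomposition *)

Lemma connect_cut (V : finType) (r : rel V) (S : {set V}) (u v : V) :
  connect r u v -> u \in S -> v \notin S ->
  exists a b, [/\ r a b, a \in S & b \notin S].
Proof.
move=> /connectP[p rp ->]; elim: p u rp => [|w p IHp] u /= => [_ -> //|].
(* The first step of the path that leaves [S] is the pair sought. *)
case/andP=> ruw rp uS vS; have [wS|wS] := boolP (w \in S).
  exact: IHp rp wS vS.
by exists u, w.
Qed.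

Theorem mainTheorem5 (R : realType) (V : finType) (E : {set {set V}}) (d : nat)
    (hG : network_graph E) (hd : (2 <= d)%N) :
  SSW (W_E E R[i]%type d).
Proof.
case: hG => _ hE hconn; have d_gt0 : (0 < d)%N by apply: ltnW.
split; last first.
  eexists; split; last exact: W_E_expand.
  exact: W_E_weight_real.
split=> [|S /set0Pn[u uS] ST].
  (* Hermiticity comes from the real weights in the expansion. *)
  rewrite W_E_expand //; apply: hermsymmx_sum => T; first exact: W_E_weight_real.
  by case: (psd_projT R[i] hE d_gt0 T).
have [v vS] : exists v, v \notin S.
  by apply/existsP; rewrite -negb_forall; apply: contra ST => /forallP SA;
     apply/eqP/setP => k; rewrite SA inE.
have [a [b [abE aS bS]]] := connect_cut (hconn u v) uS vS.
pose f : edge E := exist _ [set a; b] abE.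
(* [Gamma S] is an involution, so taking [Q] to be the transposed cut tensor restores that tensor in
   [P + Gamma S Q]. *)
exists (W_E E R[i]%type d - tensor (cut_op R[i] d f)).
exists (Gamma S (tensor (cut_op R[i] d f))); split.
- exact: psd_W_E_sub_cut.
- by apply: gram_psd; apply: (gram_Gamma_cut _ hE d_gt0 _ aS bS).
- by rewrite /Gamma ptransposeK subrK.
Qed.
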